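(* Let $k\geq 3$ be an integer. For $\alpha_2,\alpha_3>0$ and $\mathbf{x}=(x_1,x_2,x_3)$ put $f_{\alpha_2,\alpha_3}(\mathbf{x})=x_1^k-\alpha_2x_2^k-\alpha_3x_3^k$. Then for almost all $(\alpha_2,\alpha_3)\in[1/2,1]^2$ (with respect to Lebesgue measure), for every $\varepsilon>0$ and large real $P$, $$\min_{\substack{\mathbf{x}\in\mathbb{Z}^3\\ \max_i|x_i|\sim P}}|f_{\alpha_2,\alpha_3}(\mathbf{x})|\ll P^{k-3+\varepsilon},$$ where the implied constant may depend on $\alpha_2$, $\alpha_3$ (and $k,\varepsilon$).
   Context: $\max_i|x_i|\sim P$ means $P\ll\max_i|x_i|\ll P$ (the vector $\mathbf{x}$ is of size comparable to $P$; in particular it is non-zero). *)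

(* Defs.v *)
From HB Require Import structures.
From mathcomp Require Import all_boot all_order all_algebra.
From mathcomp Require Import all_classical all_reals all_analysis.
Set Implicit Arguments.
Unset Strict Implicit.
Unset Printing Implicit Defensive.
Import Order.TTheory GRing.Theory Num.Theory.
Import numFieldNormedType.Exports.
Local Open Scope classical_set_scope.
Local Open Scope ring_scope.

(* Coordinates x_1, x_2, x_3 are indexed by 0, 1, 2 : 'I_3. *)
Definition ternary_form (R : realType) (k : nat) (a2 a3 : R)
    (x : 'rV[int]_3) : R :=
  (x 0 0)%:~R ^+ k - a2 * (x 0 1)%:~R ^+ k - a3 * (x 0 2)%:~R ^+ k.

Definition height (x : 'rV[int]_3) : nat := \max_(i < 3) `|x ord0 i|%N.

(* The relation max_i |x_i| ~ P with its two implied constants c and C made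
   explicit. *)
Definition comparable_height (R : realType) (c C P : R) (x : 'rV[int]_3) :
    Prop :=
  c * P <= (height x)%:R /\ (height x)%:R <= C * P.

(* An attained minimum, so in particular A is nonempty; the library's inf
   would be 0 on the empty set. *)
Definition is_min (R : realType) (A : set R) (m : R) : Prop :=
  A m /\ lbound A m.

Definition form_values (R : realType) (k : nat) (a2 a3 c C P : R) : set R :=
  [set `|ternary_form k a2 a3 x| | x in [set x | comparable_height c C P x]].

(* Main.v *)
Require Import Defs.
From HB Require Import structures.
From mathcomp Require Import all_boot all_order all_algebra.
From mathcomp Require Import all_classical all_reals all_analysis.
From mathcomp Require Import measurable_realfun.
From mathcomp Require Import ring lra zify.
Set Implicit Arguments.
Unset Strict Implicit.
Unset Printing Implicit Defensive.
Import Order.TTheory GRing.Theory Num.Theory.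
Import numFieldNormedType.Exports.
Local Open Scope classical_set_scope.
Local Open Scope ring_scope.

(** A second moment argument.  For integers x_2, x_3 in [N, 2N), N = 2^j, put
    L_x(a) = a_2 x_2^k + a_3 x_3^k and delta = N^(k-3) j^3.  Let psi be the
    indicator of the union of the [n^k, n^k + delta] minus its average over each
    gap [n^k, (n+1)^k], so that the integral of psi over any interval is at most
    delta in absolute value.  If a has no solution of |f_a(x)| <= delta at scale
    N, then sum_x psi(L_x(a)) <= - j^3 / (k 4^(k-1)).  For x and y not parallel,
    integrating psi(L_x) psi(L_y) along the lines on which L_x is constant bounds
    its integral over the unit square by delta ||psi||_1 / |det|, where det is the
    determinant of the coefficients of L_x and L_y.  Summing over all pairs (the
    parallel ones, and the determinants of given size, are counted by
    gcd(x_2, x_3)), the second moment of sum_x psi(L_x) is O(j^4), so the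
    exceptional set at scale 2^j has measure O(j^-2), and Borel-Cantelli
    gives the bound P^(k-3) (log P)^3. *)

(** * Affine changes of variable on the real line *)

Section AffineSubstitution.
Variable R : realType.
Local Notation mu := (@lebesgue_measure R).

Lemma measurable_affine (a b : R) :
  measurable_fun [set: measurableTypeR R]
    (fun x : measurableTypeR R => a * x + b : measurableTypeR R).
Proof. by apply: measurable_funD => //; apply: measurable_funM. Qed.

(** By uniqueness of Lebesgue measure it suffices to compare lengths of half-open intervals; for a <
    0 the preimage of such an interval is closed at the other end. *)
Lemma lebesgue_measure_affine (a b : R) (A : set (measurableTypeR R)) :
  a != 0 -> measurable A ->
  mu A = (`|a|%:E * mu ((fun x => a * x + b)%R @^-1` A))%E.
Proof.
move=> a0 mA.
pose phi := fun x : measurableTypeR R => a * x + b : measurableTypeR R.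
have mphi : measurable_fun setT phi by exact: measurable_affine.
have na : 0 <= `|a| by [].
have -> : (`|a|%:E * mu ((fun x => a * x + b)%R @^-1` A))%E =
    mscale (NngNum na) (pushforward mu phi) A by [].
apply: lebesgue_measure_unique => // _ [[u v]] /= uv <-.
rewrite /mscale/= /pushforward lebesgue_measure_itv/= !lte_fin.
case: (ltgtP a 0) a0 => // a0 _.
- rewrite [_ @^-1` _](_ : _ = `[(v - b) / a, (u - b) / a[%classic); last first.
    apply/seteqP; split => x; rewrite /phi/= !in_itv/= ler_ndivrMr// ltr_ndivlMr//; lra.
  rewrite lebesgue_measure_itv/= !lte_fin ltr_ndivrMr// divfK ?lt_eqF//.
  rewrite ltrD2r; case: ifPn => _; last by rewrite mule0.
  by rewrite -EFinB -EFinM ltr0_norm//; congr EFin; field; rewrite lt_eqF.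
- rewrite [_ @^-1` _](_ : _ = `](u - b) / a, (v - b) / a]%classic); last first.
    apply/seteqP; split => x; rewrite /phi/= !in_itv/= ler_pdivlMr// ltr_pdivrMr//; lra.
  rewrite lebesgue_measure_itv/= !lte_fin ltr_pdivrMr// divfK ?gt_eqF//.
  rewrite ltrD2r; case: ifPn => _; last by rewrite mule0.
  by rewrite -EFinB -EFinM gtr0_norm//; congr EFin; field; rewrite gt_eqF.
Qed.

Lemma ge0_integral_affine (a b : R) (f : R -> \bar R) : a != 0 ->
  measurable_fun setT f -> (forall x, 0 <= f x)%E ->
  (\int[mu]_x f x = `|a|%:E * \int[mu]_x f (a * x + b)%R)%E.
Proof.
move=> a0 mf f0.
have mphi := measurable_affine a b.
have na : 0 <= `|a| by [].
pose phi := fun x : measurableTypeR R => a * x + b : measurableTypeR R.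
rewrite (eq_measure_integral (mscale (NngNum na) (pushforward mu phi))).
  by rewrite ge0_integral_mscale// ge0_integral_pushforward.
by move=> A mA _; exact: lebesgue_measure_affine.
Qed.

Lemma integral_affine (a b : R) (f : R -> \bar R) : a != 0 ->
  mu.-integrable setT f ->
  (\int[mu]_x f x = `|a|%:E * \int[mu]_x f (a * x + b)%R)%E.
Proof.
move=> a0 intf; have mf := measurable_int _ intf.
have ap : 0 < `|a| by rewrite normr_gt0.
have hp := ge0_integral_affine b a0 (measurable_funepos mf) (funepos_ge0 f).
have hn := ge0_integral_affine b a0 (measurable_funeneg mf) (funeneg_ge0 f).
have fp := integrable_pos_fin_num measurableT intf.
(* Finiteness of the transformed positive part is what allows [|a|] to be distributed over the
   difference in the extended reals. *)
have fin I : (0 <= I -> `|a|%:E * I \is a fin_num -> I \is a fin_num)%E.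
  by case: I => //= _; rewrite gt0_muley ?lte_fin.
have p0 : (0 <= \int[mu]_x f^\+ (a * x + b)%R)%E.
  by apply: integral_ge0 => x _; exact: funepos_ge0.
rewrite hp in fp.
pose phi := fun x : R => a * x + b.
rewrite integralE hp hn -muleBr//; last exact/fin_num_adde_defr/(fin _ p0 fp).
congr (_ * _)%E; rewrite [RHS]integralE.
change (fun x => f (a * x + b)) with (f \o phi).
by rewrite (funepos_comp f phi) (funeneg_comp f phi).
Qed.

End AffineSubstitution.

(** * Shears of the plane and integrals over the unit square *)

Section Shear.
Variable R : realType.
Local Notation mu := (@lebesgue_measure R).
Local Notation mu2 := (mu \x mu)%E.
Implicit Types psi : R -> R.

Lemma itv_integrable_bounded psi (u v M : R) : measurable_fun setT psi ->
  (forall x, `|psi x| <= M) -> mu.-integrable `[u, v] (EFin \o psi).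
Proof.
move=> mpsi psiM; apply: measurable_bounded_integrable => //.
- by rewrite /= lebesgue_measure_itv/=; case: ifP => _; rewrite ?ltry// -EFinB ltry.
- exact: measurable_funTS.
- exists M; split; first exact: num_real.
  by move=> y My x _ /=; exact: le_trans (psiM x) (ltW My).
Qed.

Lemma itv_integral_affine_le psi (delta a b u v : R) : a != 0 ->
  measurable_fun setT psi -> (exists M, forall x, `|psi x| <= M) ->
  (forall u v, `|\int[mu]_(x in `[u, v]) (psi x)%:E| <= delta%:E)%E ->
  (`|\int[mu]_(x in `[u, v]) (psi (a * x + b)%R)%:E| <= (delta / `|a|)%:E)%E.
Proof.
move=> a0 mpsi [M psiM] psid.
(* The affine image of [u, v] is [u', v'] for either sign of a, so the hypothesis applies to it and
   the substitution costs 1 / |a|. *)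
pose u' := Num.min (a * u + b) (a * v + b).
pose v' := Num.max (a * u + b) (a * v + b).
have [vu|uv] := ltP v u.
  rewrite set_itv_ge ?bnd_simp -?ltNge// integral_set0 abse0 lee_fin divr_ge0//.
  by have := psid 1 0; rewrite set_itv_ge ?bnd_simp -?ltNge// integral_set0 abse0 lee_fin.
have intf : mu.-integrable setT ((EFin \o psi) \_ `[u', v']).
  apply: (integrable_mkcond (mu := mu) (EFin \o psi) _).1 => //.
  exact: itv_integrable_bounded psiM.
have := integral_affine b a0 intf.
rewrite -integral_mkcond => eq1.
have eq2 : (\int[mu]_(x in `[u, v]) (psi (a * x + b)%R)%:E =
    \int[mu]_x ((EFin \o psi) \_ `[u', v']) (a * x + b)%R)%E.
  rewrite integral_mkcond; apply: eq_integral => x _.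
  rewrite /patch; congr (if _ then _ else _).
  apply/idP/idP; rewrite !inE/= !in_itv/= /u' /v' minEle maxEle.
  + case: ifP => //; case: (ltgtP a 0) a0 => // ? _; nra.
  + case: ifP => //; case: (ltgtP a 0) a0 => // ? _; nra.
have na : 0 < `|a| by rewrite normr_gt0.
rewrite eq2 EFinM lee_pdivlMr//.
by have := psid u' v'; rewrite eq1 abseM abse_EFin normr_id muleC.
Qed.

Lemma ge0_le_integral_affine psi (a b W : R) : 0 < a -> 
  measurable_fun setT psi ->
  (\int[mu]_x (`|psi x|)%:E <= W%:E)%E ->
  (\int[mu]_x (`|psi (a * x + b)%R|)%:E <= (W / a)%:E)%E.
Proof.
move=> a0 mpsi psiW; rewrite EFinM lee_pdivlMr// muleC.
rewrite -[X in (X%:E * _)%E]gtr0_norm//.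
rewrite -(ge0_integral_affine b (f := fun x => (`|psi x|)%:E)) ?gt_eqF//.
by apply/measurable_EFinP; apply: measurableT_comp.
Qed.

Let T := measurableTypeR R.
Let sh (c : R) (z : T * T) : T * T := (z.1 - c * z.2, z.2).

Let measurable_sh c : measurable_fun setT (sh c).
Proof.
apply: measurable_fun_pair => //; apply: measurable_funB => //.
by apply: measurable_funM.
Qed.

(** By Tonelli: with the second coordinate fixed, the shear is a translation of the first. *)
Lemma integrable_shear (c : R) (g : T * T -> \bar R) :
  mu2.-integrable setT g -> mu2.-integrable setT (fun z => g (z.1 - c * z.2, z.2)).
Proof.
move=> intg; have mg := measurable_int _ intg.
have mgs : measurable_fun setT (g \o sh c).
  by apply: measurableT_comp => //; exact: measurable_sh.
apply/(integrable21ltyP mu mu mgs).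
move: (integrable21ltyP mu mu mg) => [/(_ intg)+ _].
congr (_ < _)%E; apply: eq_integral => s _.
rewrite (ge0_integral_affine (- (c * s)) (oner_neq0 R))//.
  by rewrite normr1 mul1e; apply: eq_integral => t _; rewrite mul1r.
by apply: measurableT_comp => //; exact: measurableT_comp.
Qed.

(** The inner integral on the right runs along the line z.1 + c z.2 = t. The translation is undone
    slice by slice after Fubini, for almost every s only, since only those slices are known to be
    integrable. *)
Lemma integral_shear (c : R) (g : T * T -> \bar R) :
  mu2.-integrable setT g ->
  (\int[mu2]_z g z = \int[mu]_t \int[mu]_s g ((t - c * s)%R, s))%E.
Proof.
move=> intg; have intgs := integrable_shear c intg.
rewrite -(integral21_prod_meas1 intg) -[RHS]/(\int[mu]_t \int[mu]_s (g \o sh c) (t, s))%E.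
rewrite (Fubini intgs).
apply: ae_eq_integral => //.
- exact: (measurable_fubini_G intg).
- exact: (measurable_fubini_G intgs).
have := ae_integrable2 intg; apply: filterS => s ints _.
apply: etrans (integral_affine (- (c * s)) (oner_neq0 R) ints) _.
by rewrite normr1 mul1e; apply: eq_integral => t _; rewrite mul1r.
Qed.

Local Notation Q := (`[0%R, 1%R] `*` `[0%R, 1%R] : set (T * T)).

Lemma unit_square_measure : mu2 Q = 1%E.
Proof.
by rewrite product_measure1E//= lebesgue_measure_itv/= lte_fin ltr01 oppr0 adde0 mule1.
Qed.

Let measurable_Q : measurable Q.
Proof. exact: measurableX. Qed.

Lemma measurable_linear_form (a2 a3 : R) :
  measurable_fun setT (fun z : T * T => a2 * z.1 + a3 * z.2 : T).
Proof. by apply: measurable_funD; apply: measurable_funM. Qed.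

(** * Covariances of one function along two linear forms *)

Section Covariance.
Variables (psi : R -> R) (delta W M : R).
Hypothesis mpsi : measurable_fun setT psi.
Hypothesis psiM : forall x, `|psi x| <= M.
Hypothesis psid : forall u v, (`|\int[mu]_(x in `[u, v]) (psi x)%:E| <= delta%:E)%E.
Hypothesis psiW : (\int[mu]_x (`|psi x|)%:E <= W%:E)%E.

Let M0 : 0 <= M. Proof. exact: le_trans (normr_ge0 _) (psiM 0). Qed.

Lemma measurable_psi_linear a2 a3 :
  measurable_fun setT (fun z : T * T => psi (a2 * z.1 + a3 * z.2)).
Proof. by apply: measurableT_comp => //; exact: measurable_linear_form. Qed.

Lemma integrable_psi_psi a2 a3 b2 b3 : mu2.-integrable Q
  (fun z => (psi (a2 * z.1 + a3 * z.2) * psi (b2 * z.1 + b3 * z.2))%:E).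
Proof.
apply: measurable_bounded_integrable => //.
- by rewrite [X in (X < _)%E]unit_square_measure ltry.
- by apply: measurable_funTS; apply: measurable_funM; exact: measurable_psi_linear.
- exists (M * M); split; first exact: num_real.
  move=> y My x _ /=; apply: le_trans (ltW My).
  by rewrite normrM ler_pM.
Qed.

(* After the shear t = z.1 + (a3 / a2) z.2 the first factor depends on t only, and
   the second is integrated in z.2 over an interval, whence the factor delta. *)
Lemma covariance_transverse_le (a2 a3 b2 b3 : R) : 0 < a2 -> 0 < a3 ->
  a2 * b3 - a3 * b2 != 0 ->
  (`|\int[mu2]_(z in Q)
     (psi (a2 * z.1 + a3 * z.2) * psi (b2 * z.1 + b3 * z.2))%:E|
   <= (delta * W / `|a2 * b3 - a3 * b2|)%:E)%E.
Proof.
move=> a20 a30 det0.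
set g := fun z : T * T => (psi (a2 * z.1 + a3 * z.2) * psi (b2 * z.1 + b3 * z.2))%:E.
have intg : mu2.-integrable setT (g \_ Q).
  by apply: (integrable_mkcond (mu := mu2) g _).1 => //; exact: integrable_psi_psi.
pose c := a3 / a2.
have c0 : 0 < c by rewrite divr_gt0.
(* [A] is the coefficient of s in the second form at the point (t - c s, s); that point lies in the
   square exactly when s is in [u t, v t]. *)
pose A := b3 - b2 * c.
have AE : A = (a2 * b3 - a3 * b2) / a2 by rewrite /A /c; field; rewrite gt_eqF.
have A0 : A != 0 by rewrite AE mulf_neq0// invr_neq0// gt_eqF.
have d0 : 0 <= delta by rewrite -lee_fin; exact: le_trans (abse_ge0 _) (psid 0 0).
pose u t := Num.max 0 ((t - 1) / c).
pose v t := Num.min 1 (t / c).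
have inner t : (\int[mu]_s (g \_ Q) ((t - c * s)%R, s) =
    (psi (a2 * t + 0))%:E *
      \int[mu]_(s in `[u t, v t]) (psi (A * s + b2 * t)%R)%:E)%E.
  rewrite -integralZl//; last first.
    apply: (@itv_integrable_bounded _ _ _ M) => //.
    apply: measurableT_comp => //; exact: measurable_affine.
  rewrite [RHS]integral_mkcond; apply: eq_integral => s _.
  rewrite /patch; have -> : ((t - c * s)%R, s) \in Q = (s \in `[u t, v t]%classic).
    apply/idP/idP; rewrite !inE/= !in_itv/= /u /v ge_max le_min ler_pdivrMr// ler_pdivlMr//; lra.
  case: ifP => // _; rewrite /g /= EFinM; congr ((psi _)%:E * (psi _)%:E)%E.
    by rewrite /c; field; rewrite gt_eqF.
  by rewrite /A; ring.
rewrite integral_mkcond (integral_shear c intg).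
apply: (le_trans (le_abse_integral _ _ _)) => //.
  exact: (measurable_fubini_F (integrable_shear c intg)).
apply: (@le_trans _ _ (\int[mu]_t ((delta / `|A|)%:E * (`|psi (a2 * t + 0)|)%:E))%E).
  apply: ge0_le_integral => //.
  - apply: measurableT_comp => //.
    exact: (measurable_fubini_F (integrable_shear c intg)).
  - apply: emeasurable_funM => //; apply/measurable_EFinP.
    apply: measurableT_comp => //; apply: measurableT_comp => //.
    exact: measurable_affine.
  - move=> t _; rewrite inner abseM muleC; apply: lee_pmul => //.
    by apply: itv_integral_affine_le => //; exists M.
rewrite ge0_integralZl//; first last.
- by rewrite lee_fin divr_ge0.
- apply/measurable_EFinP.
  apply: measurableT_comp => //; apply: measurableT_comp => //.
  exact: measurable_affine.
(* As [A] is the determinant divided by a2, the two factors a2 cancel. *)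
apply: (@le_trans _ _ ((delta / `|A|)%:E * (W / a2)%:E)%E).
  apply: lee_wpmul2l; first by rewrite lee_fin divr_ge0.
  exact: ge0_le_integral_affine.
have : `|a2 * b3 - a3 * b2| != 0 by rewrite normr_eq0.
rewrite -EFinM lee_fin AE normrM normfV (gtr0_norm a20).
move: `|a2 * b3 - a3 * b2| => D D0.
rewrite le_eqVlt; apply/orP; left; apply/eqP; field.
by rewrite D0 gt_eqF.
Qed.

(* No cancellation is used here; this is for parallel forms. *)
Lemma covariance_le a2 a3 b2 b3 : 0 < a2 ->
  (`|\int[mu2]_(z in Q)
     (psi (a2 * z.1 + a3 * z.2) * psi (b2 * z.1 + b3 * z.2))%:E|
   <= (M * W / a2)%:E)%E.
Proof.
move=> a20.
apply: (le_trans (le_abse_integral _ _ _)) => //.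
  exact: measurable_int (integrable_psi_psi _ _ _ _).
pose h := fun z : T * T => (`|psi (a2 * z.1 + a3 * z.2)|)%:E.
have mh : measurable_fun setT h.
  apply/measurable_EFinP; apply: measurableT_comp => //.
  exact: measurable_psi_linear.
apply: (@le_trans _ _ (\int[mu2]_(z in Q) (M%:E * h z))%E).
  apply: ge0_le_integral => //.
  - apply: measurableT_comp => //.
    exact: measurable_int (integrable_psi_psi _ _ _ _).
  - by apply: measurable_funTS; apply: emeasurable_funM.
  - by move=> z _; rewrite /h abse_EFin -EFinM lee_fin normrM mulrC ler_wpM2r.
rewrite ge0_integralZl//; [|by apply: measurable_funTS|by move=> *; rewrite ?lee_fin..].
rewrite -mulrA EFinM; apply: lee_wpmul2l => //.
have mhQ : measurable_fun setT (h \_ Q).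
  by apply: (measurable_restrictT h measurable_Q).1; exact: measurable_funTS.
have hQ0 z : (0 <= (h \_ Q) z)%E by rewrite /patch; case: ifP => // _; rewrite /h lee_fin.
(* On each horizontal slice the integral is extended to the whole line, where substitution gives W /
   a2; the slices have total height 1. *)
rewrite integral_mkcond fubini_tonelli2//.
apply: (@le_trans _ _ (\int[mu]_(s in `[0%R, 1%R]) (W / a2)%:E)%E).
  rewrite [leRHS]integral_mkcond; apply: ge0_le_integral => //.
  - by move=> s _; exact: integral_ge0.
  - exact: measurable_fun_fubini_tonelli_G.
  - by apply: (measurable_restrictT _ _).1.
  - move=> s _; rewrite -[leLHS]/(\int[mu]_t (h \_ Q) (t, s))%E [leRHS]/patch; case: ifPn => sQ; last first.
      rewrite integral0_eq// => t _; rewrite /patch ifN//.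
      by apply: contra sQ; rewrite !inE => -[].
    apply: le_trans (ge0_le_integral_affine (a3 * s) a20 mpsi psiW).
    apply: ge0_le_integral => //.
    + exact: measurableT_comp.
    + apply/measurable_EFinP; apply: measurableT_comp => //.
      by apply: measurableT_comp => //; exact: measurable_affine.
    + by move=> t _; rewrite /patch; case: ifP => // _; rewrite lee_fin.
by rewrite integral_cst//= lebesgue_measure_itv/= lte_fin ltr01 oppr0 adde0 mule1.
Qed.

End Covariance.
End Shear.

(** * The comb: short intervals after each p n, balanced over the gaps *)

Section Comb.
Variables (R : realType) (p : nat -> R) (delta : R).
Local Notation mu := (@lebesgue_measure R).
Hypothesis delta0 : 0 < delta.
Hypothesis gap : forall n, p n + delta <= p n.+1.

(* The second term is chosen to make the integral over [p n, p n.+1] vanish. *)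
Definition tooth n (s : R) : R := \1_(`[p n, p n + delta]%classic) s
  - delta / (p n.+1 - p n) * \1_(`[p n, p n.+1]%classic) s.

(** Truncated to the m gaps covering [p 0, p m], so that sums and integrals stay finite. *)
Definition comb m (s : R) : R := \sum_(n < m) tooth n s.

Let density n := delta / (p n.+1 - p n).

Let gap0 n : 0 < p n.+1 - p n.
Proof. by have := gap n; have := delta0; lra. Qed.

Let density_gap n : density n * (p n.+1 - p n) = delta.
Proof. by rewrite divfK// gt_eqF. Qed.

Let density_gt0 n : 0 < density n. Proof. by rewrite divr_gt0. Qed.

Let density_le1 n : density n <= 1.
Proof. by rewrite /density ler_pdivrMr ?gap0// mul1r; have := gap n; lra. Qed.

Lemma measurable_tooth n : measurable_fun setT (tooth n).
Proof.
apply: measurable_funB; first exact: measurable_indic.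
by apply: measurable_funM => //; exact: measurable_indic.
Qed.

Lemma measurable_comb m : measurable_fun setT (comb m).
Proof. by apply: measurable_sum => n; exact: measurable_tooth. Qed.

Lemma tooth_norm_le n s : `|tooth n s| <= \1_(`[p n, p n.+1]%classic) s.
Proof.
have := density_gt0 n; have := density_le1 n; have := gap n.
rewrite /tooth -/(density n) !indicE !mem_setE !in_itv/= ler_norml.
case: (lerP (p n) s); case: (lerP s (p n + delta)); case: (lerP s (p n.+1)) => /=; lra.
Qed.

Lemma comb_norm_le m s : `|comb m s| <= 2.
Proof.
apply: (@le_trans _ _ (\sum_(n < m) \1_(`[p n, p n.+1]%classic) s)).
  by apply: le_trans (ler_norm_sum _ _ _) _; apply: ler_sum => n _; exact: tooth_norm_le.
(* Consecutive closed gaps share an endpoint, hence 2 and not 1. The bounds at and beyond p m are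
   carried along to make the induction go through. *)
suff : [/\ \sum_(n < m) \1_(`[p n, p n.+1]%classic) s <= 2 :> R,
    p m <= s -> \sum_(n < m) \1_(`[p n, p n.+1]%classic) s <= 1 :> R &
    p m < s -> \sum_(n < m) \1_(`[p n, p n.+1]%classic) s <= 0 :> R] by case.
elim: m => [|m [IH2 IH1 IH0]]; first by rewrite big_ord0; split; lra.
have gm := gap m; have d0 := delta0.
rewrite !big_ord_recr/= indicE mem_setE in_itv/=.
case: (ltgtP (p m) s) => ps /=.
- have h0 := IH0 ps; case: (lerP s (p m.+1)) => sp; split; rewrite /= => *; lra.
- by split=> *; lra.
- have h1 : \sum_(n < m) \1_(`[p n, p n.+1]%classic) s <= 1 :> R by apply: IH1; lra.
  by case: (lerP s (p m.+1)) => sp; split; rewrite /= => *; lra.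
Qed.

(** For a <= b, a primitive of the indicator of [a, b]. *)
Let clip (a b s : R) := Num.min (Num.max s a) b.

Lemma integral_indic_itv (a b u v : R) : a <= b -> u <= v ->
  (\int[mu]_(x in `[u, v]) (\1_(`[a, b]%classic) x)%:E = (clip a b v - clip a b u)%:E)%E.
Proof.
move=> ab uv; rewrite integral_indic//=.
have -> : `[a, b]%classic `&` `[u, v]%classic = `[Num.max a u, Num.min b v]%classic :> set R.
  by apply/seteqP; split => x; rewrite /= !in_itv/= ge_max le_min; lra.
rewrite lebesgue_measure_itv/= lte_fin /clip.
rewrite !minEle !maxEle.
do ?case: ifPn; rewrite -?ltNge -?leNgt => *; rewrite -?EFinB; congr EFin; lra.
Qed.

Let primitive n s := clip (p n) (p n + delta) s - density n * clip (p n) (p n.+1) s.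

(** The common value of [primitive n] on both sides of its gap. *)
Let offset n := p n - density n * p n.

Lemma integral_tooth n u v : u <= v ->
  (\int[mu]_(x in `[u, v]) (tooth n x)%:E = (primitive n v - primitive n u)%:E)%E.
Proof.
move=> uv; rewrite /tooth; under eq_integral do rewrite EFinB EFinM.
have intI a b : mu.-integrable `[u, v] (fun x => (\1_(`[a, b]%classic) x)%:E : \bar R).
  apply: (@itv_integrable_bounded _ _ _ _ 1) => // x.
  by rewrite indicE; case: (_ \in _); rewrite ?normr1 ?normr0.
rewrite integralB//; last by apply: integrableZl.
rewrite integralZl// !integral_indic_itv//; last first.
- by have := delta0; lra.
- by have := gap0 n; lra.
by rewrite -EFinM -EFinB /primitive /density; congr EFin; ring.
Qed.

(* At most one of the [primitive n s - offset n], n < m, is nonzero: this is what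
   makes the bound of [integral_comb_le] uniform in m. *)
Lemma primitive_bounds n s :
  [/\ 0 <= primitive n s - offset n <= delta,
      s <= p n -> primitive n s = offset n &
      p n.+1 <= s -> primitive n s = offset n].
Proof.
have := density_gt0 n; have := density_le1 n; have := gap n; have := density_gap n.
rewrite /primitive /offset /clip; move: (density n) => r rg gp r1 r0.
have d0 := delta0.
rewrite !minEle !maxEle; do ?case: ifPn; rewrite -?ltNge -?leNgt => *; split; nra.
Qed.

(** The integral is the difference of the values at v and u of a single function that stays in
    [0, delta]; this gives delta rather than 2 delta. *)
Lemma integral_comb_le m u v :
  (`|\int[mu]_(x in `[u, v]) (comb m x)%:E| <= delta%:E)%E.
Proof.
have [vu|uv] := ltP v u.
  by rewrite set_itv_ge ?bnd_simp -?ltNge// integral_set0 abse0 lee_fin ltW.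
have -> : (\int[mu]_(x in `[u, v]) (comb m x)%:E =
    (\sum_(n < m) (primitive n v - primitive n u))%:E)%E.
  rewrite /comb; under eq_integral do rewrite -sumEFin.
  rewrite integral_sum//=; last first.
    move=> n; apply: (@itv_integrable_bounded _ _ _ _ 1); first exact: measurable_tooth.
    move=> x; apply: le_trans (tooth_norm_le _ _) _.
    by rewrite indicE; case: (_ \in _).
  by rewrite -sumEFin; apply: eq_bigr => n _; exact: integral_tooth.
have bnd s : 0 <= \sum_(n < m) (primitive n s - offset n) <= delta.
  suff : 0 <= \sum_(n < m) (primitive n s - offset n) <= delta /\
     (p m <= s -> \sum_(n < m) (primitive n s - offset n) = 0) by case.
  have d0 := delta0.
  (* Beyond p m all earlier terms vanish and only the new one can contribute; before p m the new one
     vanishes. *)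
  elim: m => [|m [IH IH0]]; first by rewrite big_ord0; split=> //; lra.
  rewrite big_ord_recr/=; have [b1 b2 b3] := primitive_bounds m s.
  case: (lerP (p m) s) => ps.
    rewrite (IH0 ps) add0r; split=> // /b3 ->; lra.
  have gm := gap m.
  split; first by rewrite (b2 (ltW ps)) subrr addr0.
  by move=> h; exfalso; lra.
rewrite abse_EFin lee_fin.
have -> : \sum_(n < m) (primitive n v - primitive n u) =
   \sum_(n < m) (primitive n v - offset n) - \sum_(n < m) (primitive n u - offset n).
  by rewrite -sumrB; apply: eq_bigr => n _; ring.
by have := bnd u; have := bnd v; rewrite ler_norml; lra.
Qed.

(** Each tooth costs delta on its short interval and again delta, as density times gap length, for
    the balancing term. *)
Lemma integral_norm_comb_le m :
  (\int[mu]_x (`|comb m x|)%:E <= (2 * delta * m%:R)%:E)%E.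
Proof.
pose w n (x : R) : \bar R := ((\1_(`[p n, p n + delta]%classic) x)%:E +
  (density n)%:E * (\1_(`[p n, p n.+1]%classic) x)%:E)%E.
have mI a b : measurable_fun setT (fun x : R => (\1_(`[a, b]%classic) x)%:E : \bar R).
  by apply/measurable_EFinP; exact: measurable_indic.
have w0 n x : (0 <= w n x)%E.
  by rewrite adde_ge0// ?mule_ge0// lee_fin// ltW.
have mw n : measurable_fun setT (w n).
  by apply: emeasurable_funD => //; apply: emeasurable_funM.
have intw n : (\int[mu]_x w n x = (2 * delta)%:E)%E.
  rewrite ge0_integralD//; last 3 first.
  - exact: mI.
  - by move=> x _; rewrite mule_ge0// lee_fin ltW.
  - by apply: emeasurable_funM => //; exact: mI.
  rewrite ge0_integralZl//; [|exact: mI|by rewrite lee_fin ltW].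
  rewrite !integral_indic// !setIT /= !lebesgue_measure_itv/= !lte_fin.
  rewrite ltrDl delta0 -subr_gt0 gap0 -!EFinB -EFinM density_gap -EFinD; congr EFin; ring.
apply: (@le_trans _ _ (\int[mu]_x \sum_(n < m) w n x)%E).
  apply: ge0_le_integral => //.
  - by apply/measurable_EFinP; apply: measurableT_comp => //; exact: measurable_comb.
  - by apply: emeasurable_sum => n; exact: mw.
  - move=> x _; rewrite /comb.
    apply: (@le_trans _ _ (\sum_(n < m) (`|tooth n x|)%:E)%E).
      by rewrite sumEFin lee_fin ler_norm_sum.
    apply: lee_sum => n _; rewrite /w -EFinM -EFinD lee_fin /tooth.
    apply: le_trans (ler_normB _ _) _; rewrite -/(density n) normrM.
    by rewrite (ger0_norm (ltW (density_gt0 n))) !ger0_norm.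
rewrite ge0_integral_sum//; last exact: mw.
under eq_bigr do rewrite intw.
by rewrite sumEFin sumr_const card_ord lee_fin mulr_natr.
Qed.

End Comb.

(** * Counting pairs of lattice points by determinant and gcd *)

Section Counting.
Local Close Scope classical_set_scope.
Variables (R : realType) (N : nat).
Hypothesis N0 : (0 < N)%N.
Implicit Types x y : 'I_N * 'I_N.

(* An index pair stands for the point (N + x.1, N + x.2) of [N, 2N)^2. *)
Definition det2 x y : int :=
  ((N + x.1) * (N + y.2))%N%:Z - ((N + x.2) * (N + y.1))%N%:Z.

Definition gcd2 x : nat := gcdn (N + x.1) (N + x.2).

Lemma gcd2_gt0 x : (0 < gcd2 x)%N.
Proof. by rewrite gcdn_gt0 addn_gt0 N0. Qed.

(* The solutions y form part of a coset of Z (x / gcd2 x), so y.1 is determined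
   by its quotient by (N + x.1) / gcd2 x, which is less than gcd2 x. *)
Lemma card_det2_eq x (m : int) : (#|[set y | det2 x y == m]| <= gcd2 x)%N.
Proof.
have g0 := gcd2_gt0 x; set g := gcd2 x in g0 *.
pose q := ((N + x.1) %/ g)%N; pose r := ((N + x.2) %/ g)%N.
have aE : (N + x.1 = q * g)%N by rewrite divnK// dvdn_gcdl.
have bE : (N + x.2 = r * g)%N by rewrite divnK// dvdn_gcdr.
have cqr : coprime q r.
  rewrite /coprime -(eqn_pmul2r g0) muln_gcdl -aE -bE mul1n; exact/eqP.
have q0 : (0 < q)%N by move: N0 aE; case: (q) => //; lia.
pose f y : 'I_g.-1.+1 := inord (y.1 %/ q).
have fE y : f y = (y.1 %/ q)%N :> nat.
  rewrite inordK// prednK// ltn_divLR// mulnC -aE.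
  by rewrite (leq_trans (ltn_ord _))// leq_addr.
have aux y y' : det2 x y = det2 x y' -> f y = f y' -> (y.1 <= y'.1)%N -> y = y'.
  move=> dE ffE le1.
  have e : (q * y'.2 + r * y.1 = q * y.2 + r * y'.1)%N.
    apply/eqP; rewrite -(eqn_pmul2r g0) !mulnDl !(mulnAC _ _ g) -aE -bE.
    move: dE; rewrite /det2; nia.
  have e' : (q * y'.2 = q * y.2 + r * (y'.1 - y.1))%N by rewrite mulnBr; have := leq_mul (leqnn r) le1; lia.
  have qd : (q %| y'.1 - y.1)%N.
    rewrite -(Gauss_dvdr _ cqr).
    have -> : (r * (y'.1 - y.1) = q * y'.2 - q * y.2)%N by rewrite e' addKn.
    by rewrite -mulnBr dvdn_mulr.
  have : (y'.1 - y.1 < q)%N.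
    have h : (y.1 %/ q = y'.1 %/ q)%N by rewrite -!fE ffE.
    rewrite {1}(divn_eq y'.1 q) {1}(divn_eq y.1 q) h.
    have := ltn_pmod y'.1 q0; lia.
  move=> lt; have y1 : (y'.1 - y.1 = 0)%N.
    by move: qd lt; case: (_ - _)%N => // d; move/dvdn_leq => /(_ isT); lia.
  have y2 : (y'.2 = y.2 :> nat).
    by apply/eqP; rewrite -(eqn_pmul2l q0) e' y1 muln0 addn0.
  move: y y' le1 y1 y2 {dE ffE e e' qd lt} => [a b] [a' b'] /= le1 y1 y2.
  by congr (_, _); apply: val_inj => /=; lia.
have finj : {in [set y | det2 x y == m] &, injective f}.
  move=> y y'; rewrite !inE => /eqP dy /eqP dy' ff.
  have [h|/ltnW h] := leqP y.1 y'.1; first by apply: aux; rewrite ?dy.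
  by apply/esym/aux; rewrite ?dy.
rewrite -(card_in_imset finj) (leq_trans (max_card _))// card_ord prednK//.
Qed.

Definition harmonic_sum n : R := \sum_(i < n) (i.+1%:R)^-1.

(** Division by d embeds these multiples in [0, 2N/d], so there are at most 2N/d + 1 <= 4N/d of
    them, as d <= 2N. *)
Lemma card_multiples_le d : (0 < d <= 2 * N)%N ->
  (\sum_(a < N) (d %| N + a)%N)%:R <= 4 * N%:R / d%:R :> R.
Proof.
move=> /andP[d0 dN].
rewrite ler_pdivlMr ?ltr0n// -!natrM ler_nat.
rewrite -big_mkcond/= sum1dep_card.
pose f (a : 'I_N) : 'I_(2 * N %/ d).+1 := inord ((N + a) %/ d).
have finj : {in [set a : 'I_N | (d %| N + a)%N] &, injective f}.
  move=> a a'; rewrite !inE => da da' /(congr1 val); rewrite /= !inordK; first last.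
  - by rewrite ltnS leq_div2r//; have := ltn_ord a; lia.
  - by rewrite ltnS leq_div2r//; have := ltn_ord a'; lia.
  move=> h; apply: val_inj => /=.
  have : (N + a = N + a')%N by rewrite -(divnK da) -(divnK da') h.
  lia.
have := max_card (f @: [set a : 'I_N | (d %| N + a)%N]).
rewrite (card_in_imset finj) card_ord => h.
apply: (leq_trans (leq_mul h (leqnn d))).
by rewrite mulSn; have := leq_trunc_div (2 * N) d; lia.
Qed.

(** The gcd is bounded by the sum of all common divisors d. Each d divides both coordinates for at
    most (4N/d)^2 points, and the weight d leaves 16 N^2 / d. *)
Lemma sum_gcd2_le :
  \sum_x (gcd2 x)%:R <= 16 * N%:R ^+ 2 * harmonic_sum (2 * N) :> R.
Proof.
pose c d (a : 'I_N) : R := (d %| N + a)%N%:R.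
apply: (@le_trans _ _ (\sum_x \sum_(i < 2 * N) i.+1%:R * (c i.+1 x.1 * c i.+1 x.2))).
  apply: ler_sum => x _.
  have glt : ((gcd2 x).-1 < 2 * N)%N.
    have := dvdn_leq _ (dvdn_gcdl (N + x.1) (N + x.2)); rewrite -/(gcd2 x).
    by have := gcd2_gt0 x; have := ltn_ord x.1; lia.
  rewrite (bigD1 (Ordinal glt))//= prednK ?gcd2_gt0//.
  rewrite /c dvdn_gcdl dvdn_gcdr !mulr1 lerDl.
  by apply: sumr_ge0 => i _; do !apply: mulr_ge0.
rewrite exchange_big/= mulr_sumr; apply: ler_sum => i _.
rewrite -mulr_sumr -(pair_bigA _ (fun a b => c i.+1 a * c i.+1 b))/=.
under eq_bigr do rewrite -mulr_sumr.
rewrite -mulr_suml -!natr_sum.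
have h := card_multiples_le (d := i.+1) (ltn_ord i).
have i0 : 0 < i.+1%:R :> R by [].
apply: (@le_trans _ _ (i.+1%:R * ((4 * N%:R / i.+1%:R) * (4 * N%:R / i.+1%:R)))).
  by rewrite ler_wpM2l// ler_pM.
by rewrite le_eqVlt; apply/orP; left; apply/eqP; field; rewrite gt_eqF.
Qed.

Lemma sum_det2_eq0_le :
  \sum_x \sum_(y | det2 x y == 0) (1 : R) <= \sum_x (gcd2 x)%:R.
Proof.
apply: ler_sum => x _; rewrite sumr_const ler_nat.
by have := card_det2_eq x 0; rewrite cardsE.
Qed.

Lemma det2_lt x y : (`|det2 x y| < 4 * N ^ 2)%N.
Proof.
have := ltn_ord x.1; have := ltn_ord x.2; have := ltn_ord y.1; have := ltn_ord y.2.
rewrite /det2 => h1 h2 h3 h4.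
have : ((N + x.1) * (N + y.2) < 4 * N ^ 2)%N by nia.
have : ((N + x.2) * (N + y.1) < 4 * N ^ 2)%N by nia.
lia.
Qed.

(** For fixed x the y are sorted by |det2|, which is below 4 N^2; each of the two signs of a given
    value occurs at most [gcd2 x] times. *)
Lemma sum_inv_det2_le :
  \sum_x \sum_(y | det2 x y != 0) (`|det2 x y|%N%:R : R)^-1 <=
  2 * harmonic_sum (4 * N ^ 2) * \sum_x (gcd2 x)%:R.
Proof.
rewrite mulr_sumr; apply: ler_sum => x _.
apply: (@le_trans _ _ (\sum_y \sum_(i < 4 * N ^ 2)
    (`|det2 x y|%N == i.+1)%:R * (i.+1%:R : R)^-1)).
  rewrite big_mkcond/=; apply: ler_sum => y _; case: ifPn => [d0|_]; last first.
    by apply: sumr_ge0 => i _; rewrite mulr_ge0.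
  have lt : (`|det2 x y|.-1 < 4 * N ^ 2)%N by have := det2_lt x y; lia.
  rewrite (bigD1 (Ordinal lt))//= prednK ?absz_gt0// eqxx mul1r lerDl.
  by apply: sumr_ge0 => i _; rewrite mulr_ge0.
rewrite exchange_big/= mulrAC mulr_sumr; apply: ler_sum => i _.
rewrite -mulr_suml ler_wpM2r// -natr_sum -natrM ler_nat.
rewrite -big_mkcond/= sum1dep_card.
have -> : [set y | `|det2 x y|%N == i.+1] =
    [set y | det2 x y == i.+1%:Z] :|: [set y | det2 x y == - i.+1%:Z].
  by apply/setP => y; rewrite !inE; lia.
rewrite (leq_trans (leq_card_setU _ _))// mul2n -addnn leq_add// card_det2_eq//.
Qed.

End Counting.

(** Each dyadic block of 2^j terms, all at most 2^-j, adds at most 1. *)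
Lemma harmonic_sum_exp2_le (R : realType) j : harmonic_sum R (2 ^ j) <= j.+1%:R.
Proof.
elim: j => [|j IH]; first by rewrite /harmonic_sum big_ord1 invr1.
rewrite /harmonic_sum expnS mul2n -addnn big_split_ord/=.
rewrite -[leRHS]natr1 lerD//.
apply: (@le_trans _ _ (\sum_(i < 2 ^ j) ((2 ^ j)%:R : R)^-1)).
  by apply: ler_sum => i _; rewrite lef_pV2 ?posrE ?ltr0n ?expn_gt0// ler_nat; lia.
by rewrite sumr_const card_ord -[leLHS]mulr_natr mulVf// pnatr_eq0 expn_eq0.
Qed.

(** * Differences of powers, bounded below and above *)

Section PowerGaps.
Variable R : realType.

Lemma subrXX_ge (u v : R) n : 0 <= v -> v <= u ->
  (u - v) * u ^+ n <= u ^+ n.+1 - v ^+ n.+1.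
Proof.
move=> v0 vu; rewrite !exprS.
by have := ler_wpM2l v0 (lerXn2r n v0 (le_trans v0 vu) vu); nra.
Qed.

Lemma norm_subrXX_ge (B u v : R) n : 0 <= B -> B <= u -> B <= v ->
  `|u - v| * B ^+ n <= `|u ^+ n.+1 - v ^+ n.+1|.
Proof.
move=> B0; wlog vu : u v / v <= u => [hw|].
  have [/hw//|/ltW uv Bu Bv] := leP v u.
  by rewrite distrC [leRHS]distrC; exact: hw.
move=> Bu Bv; have v0 := le_trans B0 Bv; have u0 := le_trans B0 Bu.
rewrite !ger0_norm ?subr_ge0 ?lerXn2r//.
apply: le_trans (subrXX_ge n v0 vu); rewrite ler_wpM2l ?subr_ge0//.
by rewrite lerXn2r.
Qed.

Lemma subrXX_le (B u v : R) n : 0 <= v -> v <= u -> u <= B ->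
  u ^+ n - v ^+ n <= (u - v) * (n%:R * B ^+ n.-1).
Proof.
move=> v0 vu uB; have u0 := le_trans v0 vu.
have -> : n%:R * B ^+ n.-1 = \sum_(i < n) B ^+ n.-1.
  by rewrite sumr_const card_ord mulr_natl.
rewrite subrXX ler_wpM2l ?subr_ge0//; apply: ler_sum => i _.
have hi : (i <= n.-1)%N by have := ltn_ord i; lia.
rewrite -[in leRHS](subnK hi) exprD ler_pM ?exprn_ge0//.
- by rewrite lerXn2r// nnegrE (le_trans u0).
- by rewrite lerXn2r// ?nnegrE (le_trans _ uB)// (le_trans v0).
Qed.

End PowerGaps.

(** * The second moment at a single scale N *)

Section SecondMoment.
Variables (R : realType) (kk N : nat) (tau : R).
(** Writing k as kk + 3 makes N^(k-3) a power with natural exponent. *)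
Let k := kk.+3.
Hypothesis N0 : (0 < N)%N.
Hypothesis tau0 : 0 < tau.
Hypothesis tauN : tau <= N%:R ^+ 2.
Local Notation mu := (@lebesgue_measure R).
Local Notation mu2 := (mu \x mu)%E.
Local Notation T := (measurableTypeR R).
Local Notation Q := (`[0%R, 1%R] `*` `[0%R, 1%R] : set (T * T)).

Let delta : R := N%:R ^+ kk * tau.
Let p n : R := (N + n)%N%:R ^+ k.

Let NR0 : 0 < N%:R :> R. Proof. by rewrite ltr0n. Qed.

Let delta0 : 0 < delta. Proof. by rewrite mulr_gt0// exprn_gt0. Qed.

(** Consecutive k-th powers from N^k on differ by at least N^(k-1), and [tauN] gives delta <=
    N^(k-1). *)
Let gap n : p n + delta <= p n.+1.
Proof.
rewrite -lerBrDl /p addnS -natr1.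
have h := @subrXX_ge R ((N + n)%N%:R + 1) (N + n)%N%:R kk.+2 (ler0n _ _).
apply: le_trans (h _); last by rewrite lerDl.
rewrite addrAC subrr add0r mul1r /delta.
apply: (@le_trans _ _ (N%:R ^+ kk * N%:R ^+ 2)).
  by rewrite ler_wpM2l// exprn_ge0// ltW.
rewrite -exprD addn2 lerXn2r ?nnegrE// ?addr_ge0// natrD -addrA lerDl.
by rewrite addr_ge0.
Qed.

Definition lform (x : 'I_N * 'I_N) (a : T * T) : R :=
  (N + x.1)%N%:R ^+ k * a.1 + (N + x.2)%N%:R ^+ k * a.2.

(** With 3N gaps the comb covers [N^k, (4N)^k], which contains every value of [lform] for a in
    [1/2, 1]^2. *)
Definition deviation (a : T * T) : R := \sum_x comb p delta (3 * N) (lform x a).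

Let psi := comb p delta (3 * N).
Let mpsi : measurable_fun setT psi. Proof. exact: measurable_comb. Qed.
Let psiM s : `|psi s| <= 2. Proof. exact: comb_norm_le. Qed.
Let W : R := 2 * delta * (3 * N)%:R.
Let psiW : (\int[mu]_x (`|psi x|)%:E <= W%:E)%E.
Proof. exact: integral_norm_comb_le. Qed.
Let psid u v : (`|\int[mu]_(x in `[u, v]) (psi x)%:E| <= delta%:E)%E.
Proof. exact: integral_comb_le. Qed.

Let W0 : 0 <= W. Proof. by rewrite !mulr_ge0// ltW. Qed.

Let covariance_bound (x y : 'I_N * 'I_N) : R :=
  if det2 x y == 0 then 2 * W / N%:R ^+ k
  else delta * W / (`|det2 x y|%N%:R * (N%:R ^+ 2) ^+ k.-1).

(** Both products in [det2] are at least N^2, so the difference of their k-th powers, the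
    determinant of the two forms, is at least |det2| N^(2(k-1)). *)
Lemma covariance_comb_le x y :
  (`|\int[mu2]_(z in Q) (psi (lform x z) * psi (lform y z))%:E|
    <= (covariance_bound x y)%:E)%E.
Proof.
have pos (i : 'I_N) : 0 < (N + i)%N%:R ^+ k :> R.
  by rewrite exprn_gt0// ltr0n addn_gt0 N0.
rewrite /covariance_bound; case: (eqVneq (det2 x y) 0) => [_|d0].
  apply: le_trans (covariance_le mpsi psiM psiW _ _ _ (pos x.1)) _.
  rewrite lee_fin ler_wpM2l ?(mulr_ge0 _ W0)// lef_pV2 ?posrE ?pos ?exprn_gt0//.
  by rewrite lerXn2r ?nnegrE// ler_nat leq_addr.
have dE : `|det2 x y|%N%:R * (N%:R ^+ 2) ^+ k.-1 <=
    `|(N + x.1)%N%:R ^+ k * (N + y.2)%N%:R ^+ k -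
      (N + x.2)%N%:R ^+ k * (N + y.1)%N%:R ^+ k| :> R.
  rewrite -!exprMn; apply: le_trans (@norm_subrXX_ge R (N%:R ^+ 2) _ _ _ _ _ _).
  - rewrite ler_wpM2r ?exprn_ge0// le_eqVlt; apply/orP; left; apply/eqP.
    rewrite natr_absz intr_norm /det2 rmorphB/= -!pmulrn !natrM//.
  - by rewrite exprn_ge0.
  - by rewrite expr2 ler_pM// ler_nat leq_addr.
  - by rewrite expr2 ler_pM// ler_nat leq_addr.
have pd : 0 < `|det2 x y|%N%:R * (N%:R ^+ 2) ^+ k.-1 :> R.
  by apply: mulr_gt0; [rewrite ltr0n absz_gt0|do 2 apply: exprn_gt0].
apply: le_trans (covariance_transverse_le mpsi psiM psid psiW (pos x.1) (pos x.2) _) _.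
  by rewrite -normr_gt0; exact: lt_le_trans dE.
rewrite lee_fin ler_wpM2l ?(mulr_ge0 (ltW delta0) W0)// lef_pV2 ?posrE//.
exact: lt_le_trans dE.
Qed.

Lemma deviation_sqr_integral_le :
  (\int[mu2]_(z in Q) (deviation z ^+ 2)%:E <=
   (\sum_x \sum_y covariance_bound x y)%:E)%E.
Proof.
have sqE z : (deviation z ^+ 2)%:E =
    (\sum_x \sum_y (psi (lform x z) * psi (lform y z))%:E)%E.
  rewrite expr2 /deviation mulr_suml -sumEFin; apply: eq_bigr => x _.
  by rewrite mulr_sumr -sumEFin.
under eq_integral do rewrite sqE.
have mQ : measurable Q by exact: measurableX.
have intg x y : mu2.-integrable Q (fun z => (psi (lform x z) * psi (lform y z))%:E).
  exact: (integrable_psi_psi mpsi psiM).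
rewrite integral_sum//; last by move=> x; exact: integrable_sum.
rewrite -sumEFin; apply: lee_sum => x _.
rewrite integral_sum// -sumEFin; apply: lee_sum => y _.
exact: le_trans (lee_abs _) (covariance_comb_le x y).
Qed.

(** Gaps below (4N)^k have length at most k (4N)^(k-1); N^2 times the resulting density delta / (k
    (4N)^(k-1)) is tau / c. *)
Let c : R := k%:R * 4 ^+ k.-1.
Let level : R := tau / c.

Let c0 : 0 < c. Proof. by rewrite mulr_gt0// exprn_gt0. Qed.

(** A value that misses every short interval still lies in some gap, where the balancing term alone
    is seen; there are N^2 such values. *)
Lemma deviation_le_unhit (a : T * T) :
  2^-1 <= a.1 <= 1 -> 2^-1 <= a.2 <= 1 ->
  (forall x n, (n < 3 * N)%N -> ~~ (p n <= lform x a <= p n + delta)) ->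
  deviation a <= - level.
Proof.
move=> /andP[a11 a12] /andP[a21 a22] unhit.
have N40 : 0 < (4 * N)%:R :> R by rewrite ltr0n muln_gt0.
have dens n : (n < 3 * N)%N ->
    - (delta / (p n.+1 - p n)) <= - (delta / (k%:R * (4 * N)%:R ^+ k.-1)).
  move=> n3; rewrite lerN2 ler_wpM2l ?(ltW delta0)// lef_pV2 ?posrE; last 2 first.
  - by rewrite mulr_gt0// exprn_gt0.
  - by have := gap n; have := delta0; lra.
  have h : p n.+1 - p n <=
      ((N + n.+1)%N%:R - (N + n)%N%:R) * (k%:R * (4 * N)%:R ^+ k.-1).
    by apply: subrXX_le; rewrite ?ler0n ?ler_nat// ?leq_add2l// (mulSn 3) leq_add2l.
  by apply: le_trans h _; rewrite addnS -natr1 addrAC subrr add0r mul1r.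
have one x : psi (lform x a) <= - (delta / (k%:R * (4 * N)%:R ^+ k.-1)).
  have tooth_unhit n : (n < 3 * N)%N -> tooth p delta n (lform x a) =
      - (delta / (p n.+1 - p n)) * (p n <= lform x a <= p n.+1)%R%:R.
    move=> n3; rewrite /tooth !indicE !mem_setE !in_itv/=.
    by rewrite (negbTE (unhit x n n3)) sub0r mulNr.
  have tooth_le0 n : (n < 3 * N)%N -> tooth p delta n (lform x a) <= 0.
    move=> n3; rewrite tooth_unhit// mulNr oppr_le0 mulr_ge0// divr_ge0 ?(ltW delta0)//.
    by have := gap n; have := delta0; lra.
  have powN (i : 'I_N) : 
      (N%:R ^+ k <= (N + i)%N%:R ^+ k :> R) /\ ((N + i)%N%:R ^+ k <= (2 * N)%:R ^+ k :> R).
    split; rewrite lerXn2r ?nnegrE// ler_nat ?leq_addr//.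
    by rewrite mul2n -addnn leq_add2l ltnW.
  have lower : p 0 <= lform x a.
    have [h1 _] := powN x.1; have [h2 _] := powN x.2.
    have h0 : 0 <= N%:R ^+ k :> R by rewrite exprn_ge0.
    rewrite /p addn0 /lform; nra.
  have upper : lform x a <= p (3 * N).
    have [_ h1] := powN x.1; have [_ h2] := powN x.2.
    have h0 : 0 <= (2 * N)%:R ^+ k :> R by rewrite exprn_ge0.
    have h3 : 2 * (2 * N)%:R ^+ k <= p (3 * N) :> R.
      rewrite /p -natrX -natrX -natrM ler_nat.
      have -> : (N + 3 * N = 2 * (2 * N))%N by rewrite -mulSn mulnA.
      rewrite [leqRHS]expnMn leq_mul2r; apply/orP; right.
      by rewrite -[leqLHS]expn1 leq_exp2l.
    rewrite /lform; nra.
  have [n n3 nP] : exists2 n, (n < 3 * N)%N & p n <= lform x a <= p n.+1.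
    have : exists n, (n < 3 * N)%N && (lform x a <= p n.+1).
      by exists (3 * N).-1; rewrite prednK ?muln_gt0//= upper leqnn.
    move=> ex; case: (ex_minnP ex) => n /andP[n3 up] nmin.
    exists n => //; rewrite up andbT; case: n n3 up nmin => [//|n] n3 up nmin.
    rewrite leNgt; apply/negP => h; have := nmin n.
    by rewrite (ltW h) (ltnW n3) ltnn => /(_ isT).
  (* The remaining teeth need only be non-positive, so a value shared by two gaps does no harm. *)
  rewrite /psi /comb (bigD1 (Ordinal n3))//=.
  rewrite -[leRHS]addr0 lerD//; last by apply: sumr_le0 => i _; exact: tooth_le0.
  by rewrite tooth_unhit// nP mulr1 dens.
apply: (@le_trans _ _ (\sum_(x : 'I_N * 'I_N) - (delta / (k%:R * (4 * N)%:R ^+ k.-1)))).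
  by apply: ler_sum => x _; exact: one.
rewrite sumr_const card_prod !card_ord -[leLHS]mulr_natr mulNr lerN2.
rewrite le_eqVlt; apply/orP; left; apply/eqP.
rewrite /level /c /delta !natrM exprMn /= !exprSr.
have k0 : k%:R != 0 :> R by rewrite pnatr_eq0.
have p4 : 4 ^+ kk != 0 :> R by rewrite expf_neq0.
have pN : N%:R ^+ kk != 0 :> R by rewrite expf_neq0// gt_eqF.
by field; rewrite pN p4 k0 gt_eqF.
Qed.

(** The gcd sum is at most 16 N^2 h. Parallel pairs carry the weight 2W/N^k = 12 tau / N^2, and
    transverse ones delta W / N^(2(k-1)) = 6 tau^2 / N^3 with an extra factor 2h; both products have
    the constant 192. *)
Lemma sum_covariance_bound_le (h : R) :
  harmonic_sum R (2 * N) <= h -> harmonic_sum R (4 * N ^ 2) <= h ->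
  \sum_x \sum_y covariance_bound x y <= 192 * (tau * h + tau ^+ 2 * h ^+ 2 / N%:R).
Proof.
move=> h2 h4.
have h0 : 0 <= h by apply: le_trans h2; apply: sumr_ge0 => i _; rewrite invr_ge0.
pose K : R := \sum_(x : 'I_N * 'I_N) (gcd2 x)%:R.
have K0 : 0 <= K by apply: sumr_ge0.
have KN : K <= 16 * N%:R ^+ 2 * h.
  apply: le_trans (sum_gcd2_le R N0) _; rewrite ler_wpM2l// mulr_ge0// exprn_ge0//.
pose A := 2 * W / N%:R ^+ k; pose B := delta * W / (N%:R ^+ 2) ^+ k.-1.
have A0 : 0 <= A by rewrite divr_ge0 ?exprn_ge0// (mulr_ge0 _ W0).
have B0 : 0 <= B by rewrite divr_ge0 ?exprn_ge0// (mulr_ge0 (ltW delta0) W0).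
have -> : \sum_x \sum_y covariance_bound x y =
    A * (\sum_(x : 'I_N * 'I_N) \sum_(y | det2 x y == 0) (1 : R)) +
    B * (\sum_(x : 'I_N * 'I_N) \sum_(y | det2 x y != 0) (`|det2 x y|%N%:R : R)^-1).
  rewrite !mulr_sumr -big_split/=; apply: eq_bigr => x _.
  rewrite !mulr_sumr [in RHS]big_mkcond [X in _ = _ + X]big_mkcond -big_split/=.
  apply: eq_bigr => y _; rewrite /covariance_bound.
  case: eqVneq => _ /=; first by rewrite mulr1 addr0.
  by rewrite add0r /B invfM; ring.
apply: (@le_trans _ _ (A * (16 * N%:R ^+ 2 * h) + B * (2 * h * (16 * N%:R ^+ 2 * h)))).
  apply: lerD; apply: ler_wpM2l => //.
    exact: le_trans (sum_det2_eq0_le R N0) KN.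
  apply: le_trans (sum_inv_det2_le R N0) _.
  apply: ler_pM => //; last by rewrite ler_wpM2l.
  by rewrite mulr_ge0//; apply: sumr_ge0 => i _; rewrite invr_ge0.
rewrite /A /B /W /delta natrM -exprM /k/= mulnC.
have -> : (kk.+2 * 2 = kk + kk + 4)%N by rewrite -[kk.+2]addn2 mulnDl muln2 -addnn.
rewrite -[kk.+3]addn3.
rewrite !exprD le_eqVlt; apply/orP; left; apply/eqP.
have pN : N%:R ^+ kk != 0 :> R by rewrite expf_neq0// gt_eqF.
by field; rewrite pN gt_eqF.
Qed.

(** Chebyshev's inequality for the squared deviation at height [level ^+ 2], that is tau^2 / c^2. *)
Lemma exceptional_set_measure_le (h : R) :
  harmonic_sum R (2 * N) <= h -> harmonic_sum R (4 * N ^ 2) <= h ->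
  exists E : set (T * T), [/\ measurable E,
    (mu2 E <= (192 * (kk.+3%:R * 4 ^+ kk.+2) ^+ 2 * (h / tau + h ^+ 2 / N%:R))%:E)%E &
    forall a, 2^-1 <= a.1 <= 1 -> 2^-1 <= a.2 <= 1 -> ~ E a ->
      exists x n, (n < 3 * N)%N /\
        (N + n)%N%:R ^+ kk.+3 <= lform x a <= (N + n)%N%:R ^+ kk.+3 + N%:R ^+ kk * tau].
Proof.
move=> h2 h4.
have level0 : 0 < level by rewrite divr_gt0.
have mQ : measurable Q by exact: measurableX.
have mdev : measurable_fun setT deviation.
  by apply: measurable_sum => x; exact: measurable_psi_linear.
have mg : measurable_fun Q (fun z => (deviation z ^+ 2)%:E).
  by apply: measurable_funTS; apply/measurable_EFinP; exact: measurable_funX.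
exists (Q `&` [set z | ((level ^+ 2)%:E <= `|(deviation z ^+ 2)%:E|)%E]); split.
- by apply: emeasurable_fun_c_infty => //; exact: measurableT_comp.
- have l20 : 0 < level ^+ 2 by rewrite exprn_gt0.
  have := le_integral_abse mu2 mQ mg l20.
  under eq_integral do rewrite abse_EFin ger0_norm ?sqr_ge0//.
  move=> /le_trans /(_ deviation_sqr_integral_le) /le_trans.
  have := sum_covariance_bound_le h2 h4; rewrite -lee_fin => /[swap] /[apply].
  rewrite muleC -lee_pdivlMr// -EFinM => /le_trans; apply.
  rewrite lee_fin le_eqVlt; apply/orP; left; apply/eqP.
  rewrite /level -/c /k; field.
  by rewrite !gt_eqF.
- move=> a a1 a2 nE; apply: contrapT => unhit; apply: nE; split.
    by move: a1 a2; rewrite /= !in_itv/=; lra.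
  rewrite /= lee_fin ger0_norm ?sqr_ge0//.
  suff : deviation a <= - level by nra.
  apply: deviation_le_unhit => // x n n3; apply/negP => hit; apply: unhit.
  by exists x, n.
Qed.

End SecondMoment.

(** * Attainment of the minimum *)

Section Minimum.
Variable R : realType.

(** Parametrizes the vectors of height at most B by a finite type, over which a minimizer can be
    chosen. *)
Definition box_vector B (f : {ffun 'I_3 -> 'I_B.*2.+1}) : 'rV[int]_3 :=
  \row_i ((f i)%:Z - B%:Z).

Lemma box_vector_surj B (x : 'rV[int]_3) : (height x <= B)%N ->
  exists f : {ffun 'I_3 -> 'I_B.*2.+1}, box_vector f = x.
Proof.
move=> /bigmax_leqP hx.
exists [ffun i => inord (absz (x ord0 i + B%:Z))]; apply/rowP => i.
rewrite !mxE ffunE; move: (hx i isT); move: (x ord0 i) => z hz.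
by rewrite inordK; lia.
Qed.

Lemma form_values_has_min k (a2 a3 c C P m0 : R) :
  form_values k a2 a3 c C P m0 ->
  exists m, is_min (form_values k a2 a3 c C P) m /\ m <= m0.
Proof.
move=> [x0 [x0l x0u] <-].
pose B := Num.truncn (C * P).
have CP0 : 0 <= C * P by apply: le_trans x0u.
have boxP x : comparable_height c C P x -> exists f : {ffun 'I_3 -> 'I_B.*2.+1}, box_vector f = x.
  by move=> [_ xu]; apply: box_vector_surj; rewrite truncn_ge_nat.
have [f0 f0E] := boxP x0 (conj x0l x0u).
pose Pr (f : {ffun 'I_3 -> 'I_B.*2.+1}) := `[< comparable_height c C P (box_vector f) >].
pose F (f : {ffun 'I_3 -> 'I_B.*2.+1}) := `|ternary_form k a2 a3 (box_vector f)|.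
have Pf0 : Pr f0 by apply/asboolP; rewrite f0E.
case: (arg_minP F Pf0) => f /asboolP Pf fmin.
exists (F f); split; last by rewrite -f0E; exact: fmin.
split; first by exists (box_vector f).
move=> _ [x xP <-]; have [g gE] := boxP x xP.
by rewrite -gE; apply: fmin; apply/asboolP; rewrite gE.
Qed.

End Minimum.

(** With s = e ln 2 / (n+1), the right-hand power is exp(j s)^(n+1), and exp(j s) >= j s. *)
Lemma pow_le_powR_exp2 (R : realType) (n : nat) (e : R) : 0 < e ->
  exists2 K : R, 0 < K & forall j, j%:R ^+ n.+1 <= K * (2 ^+ j) `^ e.
Proof.
move=> e0; pose s := e * ln 2 / n.+1%:R.
have s0 : 0 < s by rewrite divr_gt0// mulr_gt0// ln_gt0// ltr1n.
exists (s ^- n.+1); first by rewrite invr_gt0 exprn_gt0.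
move=> j; rewrite mulrC ler_pdivlMr ?exprn_gt0// -exprMn.
have -> : (2 ^+ j) `^ e = expR (j%:R * s) ^+ n.+1.
  rewrite /powR ifF; last by rewrite gt_eqF ?exprn_gt0.
  rewrite lnXn// -expRM_natl; congr expR.
  have : n.+1%:R != 0 :> R by rewrite pnatr_eq0.
  rewrite /s -(mulr_natl (ln _)); move: n.+1%:R => m m0.
  by field.
rewrite lerXn2r ?nnegrE ?expR_ge0//; first by rewrite mulr_ge0// ltW.
by apply: le_trans (expR_ge1Dx _); rewrite lerDr.
Qed.

(** * Borel-Cantelli for measures of order 1/j^2 *)

Section BorelCantelli.
Context d (T : measurableType d) (R : realType) (mu : {measure set T -> \bar R}).

Lemma ae_eventually_notin (E : (set T)^nat) (C : R) : 0 <= C ->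
  (forall j, measurable (E j)) ->
  (forall j, (mu (E j) <= (C / j.+1%:R ^+ 2)%:E)%E) ->
  {ae mu, forall a, exists n, forall j, (n <= j)%N -> ~ E j a}.
Proof.
move=> C0 mE muE.
have sumfin : (\sum_(n <oo) mu (E n) < +oo)%E.
  apply: (@le_lt_trans _ _ (2 * C)%:E); last by rewrite ltry.
  apply: lime_le; first exact: is_cvg_nneseries.
  apply: nearW => n.
  (* Comparison with a telescoping series: 1/y^2 <= 2 (1/y - 1/(y+1)) for y >= 1. *)
  apply: (@le_trans _ _ (\sum_(0 <= i < n) (2 * C * (i.+1%:R^-1 - i.+2%:R^-1))%:E)%E).
    apply: lee_sum => i _; apply: le_trans (muE i) _; rewrite lee_fin.
    rewrite (mulrC 2) -mulrA ler_wpM2l//.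
    have i1 : 0 < i.+1%:R :> R by [].
    have i2 : 0 < i.+2%:R :> R by [].
    have e : i.+2%:R = i.+1%:R + 1 :> R by rewrite natr1.
    have i1' : 1 <= i.+1%:R :> R by rewrite ler1n.
    rewrite -[leLHS]mul1r ler_pdivrMr ?exprn_gt0// e.
    move: i1 i1'; move: (i.+1%:R) => y y0 y1.
    have -> : 2 * (y^-1 - (y + 1)^-1) * y ^+ 2 = 2 * y / (y + 1).
      by field; rewrite !gt_eqF//; lra.
    by rewrite ler_pdivlMr; lra.
  rewrite sumEFin lee_fin -mulr_sumr -[leRHS]mulr1 ler_wpM2l ?mulr_ge0//.
  suff -> : \sum_(0 <= i < n) (i.+1%:R^-1 - i.+2%:R^-1) = 1 - n.+1%:R^-1 :> R.
    by rewrite gerBl invr_ge0.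
  elim: n => [|n IH]; first by rewrite big_geq// invr1 subrr.
  by rewrite big_nat_recr//= IH addrA subrK.
exists (lim_sup_set E); split.
- by apply: bigcap_measurable => // n _; exact: bigcup_measurable.
- exact: lim_sup_set_cvg0.
- move=> a; apply: contra_notP => nlim.
  have [n nE] : exists n, ~ (\bigcup_(j >= n) E j) a.
    by apply: contrapT => h; apply: nlim => n _; apply: contrapT => hn; apply: h; exists n.
  by exists n => j nj Eja; apply: nE; exists j.
Qed.

End BorelCantelli.

(** * Dyadic scales and the conclusion *)

Lemma pow3_le_pow4 j : (j ^ 3 <= 4 ^ j)%N.
Proof.
elim: j => [//|[//|[//|j]] IH].
by rewrite expnS; apply: leq_trans (leq_mul (leqnn 4) IH); nia.
Qed.

Lemma ternary_form_row (R : realType) k (a2 a3 : R) (n1 n2 n3 : nat) :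
  let x := \row_(i < 3) (nth 0%N [:: n1; n2; n3] i)%:Z in
  ternary_form k a2 a3 x = n1%:R ^+ k - a2 * n2%:R ^+ k - a3 * n3%:R ^+ k /\
  height x = maxn n1 (maxn n2 n3).
Proof.
split; first by rewrite /ternary_form !mxE.
by rewrite /height !big_ord_recl big_ord0 !mxE /= maxn0.
Qed.

Lemma exp2_bracket (R : realType) (n : nat) (P : R) : 2 ^+ n <= P ->
  exists2 j, (n <= j)%N & 2 ^+ j <= P < 2 ^+ j.+1.
Proof.
move=> nP; have P0 : 0 <= P by apply: le_trans nP; rewrite exprn_ge0.
have t0 : (2 ^ n <= Num.truncn P)%N by rewrite truncn_ge_nat// natrX.
exists (trunc_log 2 (Num.truncn P)); first exact: trunc_log_max.
have tp : (0 < Num.truncn P)%N by apply: leq_trans t0; rewrite expn_gt0.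
rewrite -!natrX -truncn_ge_nat// -truncn_lt_nat// trunc_logP//=.
exact: trunc_log_ltn.
Qed.

(** Here N = 2^(j+1), tau = (j+1)^3 and h = 5 (j+1). Then h / tau = 5 / (j+1)^2, while h^2 / N is at
    most 25 K / (j+1)^2 because (j+1)^4 <= K 2^(j+1). The shift by one keeps tau positive. *)
Lemma dyadic_exceptional_sets (R : realType) (kk : nat) :
  exists C : R, exists E : nat -> set (measurableTypeR R * measurableTypeR R),
  [/\ 0 <= C, forall j, measurable (E j),
    forall j, ((lebesgue_measure \x lebesgue_measure) (E j) <= (C / j.+1%:R ^+ 2)%:E)%E &
    forall j a, 2^-1 <= a.1 <= 1 -> 2^-1 <= a.2 <= 1 -> ~ E j a ->
      exists (x : 'I_(2 ^ j.+1) * 'I_(2 ^ j.+1)) n, (n < 3 * 2 ^ j.+1)%N /\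
        (2 ^ j.+1 + n)%N%:R ^+ kk.+3 <= lform kk x a <=
        (2 ^ j.+1 + n)%N%:R ^+ kk.+3 + (2 ^ j.+1)%N%:R ^+ kk * j.+1%:R ^+ 3].
Proof.
have [K K0 jK] := pow_le_powR_exp2 3 (@ltr01 R).
pose C0 : R := 192 * (kk.+3%:R * 4 ^+ kk.+2) ^+ 2.
have C00 : 0 <= C0 by rewrite mulr_ge0// exprn_ge0// mulr_ge0// exprn_ge0.
exists (C0 * (5 + 25 * K)).
suff /choice[E EP] : forall j, exists E : set (measurableTypeR R * measurableTypeR R),
    [/\ measurable E,
    ((lebesgue_measure \x lebesgue_measure) E <= (C0 * (5 + 25 * K) / j.+1%:R ^+ 2)%:E)%E &
    forall a, 2^-1 <= a.1 <= 1 -> 2^-1 <= a.2 <= 1 -> ~ E a ->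
      exists (x : 'I_(2 ^ j.+1) * 'I_(2 ^ j.+1)) n, (n < 3 * 2 ^ j.+1)%N /\
        (2 ^ j.+1 + n)%N%:R ^+ kk.+3 <= lform kk x a <=
        (2 ^ j.+1 + n)%N%:R ^+ kk.+3 + (2 ^ j.+1)%N%:R ^+ kk * j.+1%:R ^+ 3].
  exists E; split; [|by move=> j; case: (EP j)..].
  by rewrite mulr_ge0// addr_ge0// mulr_ge0// ltW.
move=> j.
have N0 : (0 < 2 ^ j.+1)%N by rewrite expn_gt0.
have tau0 : 0 < j.+1%:R ^+ 3 :> R by rewrite exprn_gt0.
have tauN : j.+1%:R ^+ 3 <= (2 ^ j.+1)%N%:R ^+ 2 :> R.
  by rewrite -!natrX ler_nat -expnM mulnC expnM; exact: pow3_le_pow4.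
have h2 : harmonic_sum R (2 * 2 ^ j.+1) <= 5 * j.+1%:R.
  by rewrite -expnS (le_trans (harmonic_sum_exp2_le _ _))// -natrM ler_nat; lia.
have h4 : harmonic_sum R (4 * (2 ^ j.+1) ^ 2) <= 5 * j.+1%:R.
  rewrite -expnM -(expnD 2 2) (le_trans (harmonic_sum_exp2_le _ _))//.
  by rewrite -natrM ler_nat; lia.
have [E [mE muE hit]] := exceptional_set_measure_le kk N0 tau0 tauN h2 h4.
exists E; split => //; apply: le_trans muE _; rewrite lee_fin -/C0.
rewrite -mulrA ler_wpM2l// ler_pdivlMr ?exprn_gt0//.
have := jK j.+1; rewrite powRr1 ?exprn_ge0// natrX.
have j0 : 0 < j.+1%:R :> R by [].
have p0 : 0 < 2 ^+ j.+1 :> R by rewrite exprn_gt0.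
move: (j.+1%:R : R) (2 ^+ j.+1 : R) j0 p0 => y q y0 q0 yK.
have -> : (5 * y / y ^+ 3 + (5 * y) ^+ 2 / q) * y ^+ 2 = 5 + 25 * (y ^+ 4 / q).
  by field; rewrite !gt_eqF.
by rewrite lerD2l ler_wpM2l// ler_pdivrMr.
Qed.

Theorem theorem3 (R : realType) (k : nat) (hk : (3 <= k)%N) :
  exists c C : R, 0 < c /\ 0 < C /\
    {ae (lebesgue_measure \x lebesgue_measure)%E,
      forall a : measurableTypeR R * measurableTypeR R,
        2^-1 <= a.1 <= 1 -> 2^-1 <= a.2 <= 1 ->
        forall e : R, 0 < e ->
          exists K : R, \forall P \near +oo_R,
            exists m : R, is_min (form_values k a.1 a.2 c C P) m /\
              m <= K * P `^ (k%:R - 3 + e)}.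
Proof.
(* The vector found has height between N and 4N, where N <= P < 2N. *)
exists 2^-1, 4; split; [by rewrite invr_gt0|split=> //].
have [kk kE] : exists kk, k = kk.+3 by exists (k - 3)%N; lia.
have [C [E [C0 mE muE hit]]] := dyadic_exceptional_sets R kk.
have := ae_eventually_notin C0 mE muE; apply: filterS => a [n0 nE] a1 a2 e e0.
have [K K0 jK] := pow_le_powR_exp2 2 e0.
exists K; near=> P.
have PN : 2 ^+ n0.+1 <= P by near: P; apply: nbhs_pinfty_ge; exact: num_real.
have P0 : 0 <= P by apply: le_trans PN; rewrite exprn_ge0.
(* As P >= 2^(n0+1), the bracketing exponent is some j + 1 with j >= n0, which matches the shifted
   index of [E]. *)
have [[//|j] nj /andP[jP Pj]] := exp2_bracket PN.
have [x [n [n3 /andP[lo up]]]] := hit j a a1 a2 (nE j nj).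
pose N := (2 ^ j.+1)%N; rewrite -/N in x n3 lo up *.
pose v : 'rV[int]_3 := \row_i (nth 0%N [:: N + n; N + x.1; N + x.2] i)%:Z.
have [fE hE] := ternary_form_row k a.1 a.2 (N + n) (N + x.1) (N + x.2).
have vh : (N <= height v <= 4 * N)%N.
  by rewrite hE; have := ltn_ord x.1; have := ltn_ord x.2; lia.
have NP : N%:R <= P by rewrite natrX.
have PN2 : P < 2 * N%:R by rewrite natrX -exprS.
have mem : form_values k a.1 a.2 2^-1 4 P `|ternary_form k a.1 a.2 v|.
  exists v => //; move: vh => /andP[].
  rewrite -!(ler_nat R) natrM => vl vu; split; lra.
have [m [mmin mle]] := form_values_has_min mem.
exists m; split=> //; apply: le_trans mle _.
(* The form at [v] is (N+n)^k minus [lform], hence between -delta and 0. *)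
apply: (@le_trans _ _ (N%:R ^+ kk * j.+1%:R ^+ 3)).
  rewrite fE ler_norml; move: lo up; rewrite /lform kE.
  set u := (N + n)%N%:R ^+ _; set w1 := (N + x.1)%N%:R ^+ _; set w2 := (N + x.2)%N%:R ^+ _.
  by rewrite (mulrC w1) (mulrC w2); lra.
have NR0 : 0 < N%:R :> R by rewrite ltr0n expn_gt0.
(* The factor (j+1)^3 is absorbed by K N^e; then N <= P suffices, the exponent being
   non-negative. *)
apply: (@le_trans _ _ (K * N%:R `^ (k%:R - 3 + e))).
  have -> : k%:R - 3 + e = kk%:R + e by rewrite kE -addn3 natrD addrK.
  rewrite powRD; last by rewrite (gt_eqF NR0) implybT.
  rewrite (powR_mulrn kk (ltW NR0)) [leRHS]mulrCA ler_wpM2l ?exprn_ge0//.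
  by rewrite natrX; exact: jK.
rewrite ler_wpM2l ?(ltW K0)// ge0_ler_powR ?nnegrE ?(ltW NR0)//.
by rewrite addr_ge0 ?(ltW e0)// subr_ge0 ler_nat.
Unshelve. all: by end_near. Qed.
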